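(* For each $T>0$, the Loewner mapping $\mathcal{L}_T: L^1_{\mathbb{T}}[0,T]\rightarrow \Sigma'$, $\mathcal{L}_T[\varphi](z)=e^{-T}f_T(z)$, is continuous, where $f_T$ is the time-$T$ solution of the exterior-disk Loewner equation $$\partial_t f_t(z)=z\,\partial_z f_t(z)\,\frac{z+\varphi(t)}{z-\varphi(t)},\qquad f_0(z)=z,\qquad z\in\Delta,$$ with driving function $\varphi$.
   Context: $\mathbb{T}$ is the unit circle and $\Delta=\{z\in\mathbb{C}_\infty: |z|>1\}$ is the exterior disk. $L^1_{\mathbb{T}}[0,T]$ is the space of all measurable functions $\varphi:[0,T]\to\mathbb{T}$ (functions equal a.e. being identified), with the metric $\|\varphi-\psi\|_1=\int_0^T|\varphi(s)-\psi(s)|\,ds$. $\Sigma$ is the class of univalent functions $f$ in $\Delta$ with expansion at infinity $f(z)=z+b_0+\sum_{n\ge1}b_nz^{-n}$; $\Sigma'$ is the subclass of those $f\in\Sigma$ whose omitted set $\mathbb{C}\setminus f(\Delta)$ contains the origin. $\Sigma'$ carries the topology of uniform convergence on compact subsets (of $\{z\in\mathbb{C}:|z|>1\}$). For a measurable driving function the Loewner equation is understood to hold for almost every $t$. Its solution $f_t$ is the inverse of $g_t$, where $g_t$ solves the ordinary differential equation $\partial_t g_t(z)=g_t(z)\frac{\varphi(t)+g_t(z)}{\varphi(t)-g_t(z)}$, $g_0(z)=z$, for $z\in\Delta$ up to the first time $\tau_z$ at which $\inf_{0\le s\le t}|g_s(z)-\varphi(s)|=0$. The function $f_t$ maps $\Delta$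 conformally onto the complement of a compact set, $f_t(z)=e^tz+\cdots$ at infinity, and $e^{-t}f_t\in\Sigma'$. *)

(* Defs.v *)
From HB Require Import structures.
From mathcomp Require Import all_boot all_order all_algebra.
From mathcomp Require Import complex.
From mathcomp Require Import all_classical all_reals all_analysis.

Set Implicit Arguments.
Unset Strict Implicit.
Unset Printing Implicit Defensive.

Import Order.TTheory GRing.Theory Num.Theory.
Import numFieldNormedType.Exports.
Import ComplexField.Normc.

Local Open Scope classical_set_scope.
Local Open Scope ring_scope.
Local Open Scope complex_scope.

(* The finite part of the exterior disk. *)
Definition Delta (R : realType) : set R[i] := [set z | 1 < normc z].
Arguments Delta : clear implicits.

(* The modulus [normc] is real-valued, whereas MathComp's [`|z|] lives in R[i];
   [R[i]^o] is R[i] with its usual topology and complex normed structure. *)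

Definition holomorphic_on (R : realType) (A : set R[i]) (f : R[i] -> R[i]) :=
  forall z, A z -> derivable (f : R[i]^o -> R[i]^o) z 1.

Definition univalent_on (R : realType) (A : set R[i]) (f : R[i] -> R[i]) :=
  holomorphic_on A f /\
  forall z w, A z -> A w -> f z = f w -> z = w.

(* Functions of Delta are total functions whose values off Delta are ignored;
   the point at infinity is a fixed point by the form of the expansion. *)
Definition is_Sigma (R : realType) (f : R[i] -> R[i]) :=
  univalent_on (Delta R) f /\
  exists b : nat -> R[i], forall z, Delta R z ->
    series (fun n => b n / z ^+ n : R[i]^o) @ \oo --> (f z - z : R[i]^o).

Definition is_Sigma' (R : realType) (f : R[i] -> R[i]) :=
  is_Sigma f /\ ~ (exists2 z, Delta R z & f z = 0).

Record Sigma' (R : realType) := MkSigma' {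
  Sigma'_fun :> R[i] -> R[i];
  Sigma'P : is_Sigma' Sigma'_fun }.

(* A representative of an element of L^1_T[0, T]; values outside [0, T] are
   irrelevant.  Two drives are identified when [L1dist] vanishes. *)
Record drive (R : realType) (T : R) := MkDrive {
  drive_fun :> R -> R[i];
  measurable_drive_Re :
    measurable_fun `[0, T] (fun t => complex.Re (drive_fun t));
  measurable_drive_Im :
    measurable_fun `[0, T] (fun t => complex.Im (drive_fun t));
  drive_circle : forall t, t \in `[0, T] -> normc (drive_fun t) = 1 }.

Definition L1dist (R : realType) (T : R) (phi psi : drive T) : R :=
  \int[lebesgue_measure]_(s in `[0, T]) normc (phi s - psi s).

Definition cintegrable (R : realType) (A : set R) (v : R -> R[i]) :=
  lebesgue_measure.-integrable A (fun s => (complex.Re (v s))%:E) /\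
  lebesgue_measure.-integrable A (fun s => (complex.Im (v s))%:E).

Definition cintegral (R : realType) (A : set R) (v : R -> R[i]) : R[i] :=
  (\int[lebesgue_measure]_(s in A) complex.Re (v s)) +i*
  (\int[lebesgue_measure]_(s in A) complex.Im (v s)).

(* Absolute continuity on [0, t], as being an indefinite Lebesgue integral. *)
Definition abs_continuous0 (R : realType) (t : R) (g : R -> R[i]) :=
  exists2 v : R -> R[i], cintegrable `[0, t] v &
    forall s, s \in `[0, t] -> g s = g 0 + cintegral `[0, s] v.

(* Derivative of a complex-valued function of a real variable. *)
Definition is_tderive (R : realType) (s : R) (g : R -> R[i]) (d : R[i]) :=
  is_derive s (1 : R) (fun r => complex.Re (g r)) (complex.Re d) /\
  is_derive s (1 : R) (fun r => complex.Im (g r)) (complex.Im d).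

(* [loewner_orbit phi w t g]: t < tau_w and g s = g_s(w) for 0 <= s <= t.
   Since phi is only measurable, the ordinary differential equation is meant
   in the sense of Caratheodory. *)
Definition loewner_orbit (R : realType) (phi : R -> R[i]) (w : R[i]) (t : R)
    (g : R -> R[i]) :=
  [/\ g 0 = w,
      abs_continuous0 t g,
      {ae lebesgue_measure, forall s, s \in `]0, t[ ->
        is_tderive s g (g s * ((phi s + g s) / (phi s - g s)))} &
      0 < inf [set normc (g s - phi s) | s in `[0, t]]].

(* [f t] is the solution f_t, for 0 <= t <= T, of the exterior-disk Loewner
   equation driven by phi: it satisfies the partial differential equation for
   almost every t, and f_t is the inverse of g_t, which sends the end point
   g t of an orbit of time t to its starting point w. *)
Definition loewner_solution (R : realType) (T : R) (phi : R -> R[i])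
    (f : R -> R[i] -> R[i]) :=
  [/\ forall z, Delta R z -> f 0 z = z,
      {ae lebesgue_measure, forall t, t \in `]0, T[ ->
        forall z, Delta R z ->
        exists2 d : R[i],
          is_derive (z : R[i]^o) 1 (f t : R[i]^o -> R[i]^o) d &
          is_tderive t (f^~ z) (z * d * ((z + phi t) / (z - phi t)))},
      forall t z, t \in `[0, T] -> Delta R z ->
        Delta R (f t z) /\
        exists2 g, loewner_orbit phi (f t z) t g & g t = z &
      forall t w g, t \in `[0, T] -> Delta R w -> loewner_orbit phi w t g ->
        Delta R (g t) /\ f t (g t) = w].

Definition loewner_mapping (R : realType) (T : R)
    (L : drive T -> Sigma' R) :=
  forall phi : drive T, exists2 f, loewner_solution T phi f &
    forall z, Delta R z -> L phi z = (expR (- T))%:C * f T z.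

(* Continuity from the metric [L1dist] to the topology of uniform convergence
   on compact subsets of Delta. *)
Definition loewner_continuous (R : realType) (T : R)
    (L : drive T -> Sigma' R) :=
  forall (phi : drive T) (K : set R[i]), compact (K : set R[i]^o) ->
  K `<=` Delta R -> forall e : R, 0 < e ->
  exists2 d : R, 0 < d & forall psi : drive T, L1dist phi psi < d ->
    forall z, K z -> normc (L phi z - L psi z) < e.

(* Main.v *)
Require Import Defs.
From mathcomp Require Import all_boot all_order all_algebra.
From mathcomp Require Import ring lra complex.
From mathcomp Require Import all_classical all_reals all_analysis.
From mathcomp Require Import measurable_realfun.

Set Implicit Arguments.
Unset Strict Implicit.
Unset Printing Implicit Defensive.

Import Order.TTheory GRing.Theory Num.Theory.
Import numFieldNormedType.Exports.
Import ComplexField.Normc.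

Local Open Scope classical_set_scope.
Local Open Scope ring_scope.
Local Open Scope complex_scope.

(** On the interval [0, T] run the orbits of two drives backwards from a common
    end point z.  Since the Loewner field z (zeta + z) / (zeta - z) points
    towards the disk, the modulus increases along backward orbits, so both stay
    in {|x| >= |z|}.  There, at a positive distance from the unit circle, the
    field is Lipschitz in the position and in the drive jointly; Gronwall's
    inequality bounds the distance of the starting points f_T(z) by a multiple
    of the L^1 distance of the drives, with a constant depending only on T and
    on a lower bound > 1 of |z|, hence uniform over compact sets. *)

(** * Euclidean geometry of the plane and estimates on the Loewner field *)

Section ComplexDot.
Variable R : realType.
Implicit Types (z w c q : R[i]).

(** The Euclidean inner product of the plane, that is the real part of [conj(c) z]. *)
Definition cdot c z : R :=
  complex.Re c * complex.Re z + complex.Im c * complex.Im z.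

Lemma cdotBl c z w : cdot (z - w) c = cdot z c - cdot w c.
Proof. by case: c z w => [a b] [x y] [u v]; rewrite /cdot /=; ring. Qed.

Lemma normc_ge0 z : 0 <= normc z.
Proof. by case: z => x y; exact: sqrtr_ge0. Qed.

Lemma normc_sqr z : normc z ^+ 2 = cdot z z.
Proof.
by case: z => x y; rewrite /cdot /= sqr_sqrtr ?addr_ge0 ?sqr_ge0// !expr2.
Qed.

(** Cauchy-Schwarz, from Lagrange's identity: the squares of the two sides differ by the square of
    [a * y - b * x]. *)
Lemma cdot_le_normc c z : cdot c z <= normc c * normc z.
Proof.
have [le0|gt0] := lerP (cdot c z) 0.
  by apply: le_trans le0 _; rewrite mulr_ge0// normc_ge0.
rewrite -(@ler_pXn2r _ 2)// ?nnegrE ?mulr_ge0 ?normc_ge0 ?(ltW gt0)//.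
rewrite exprMn !normc_sqr; case: c z {gt0} => [a b] [x y]; rewrite /cdot /=.
by rewrite -subr_ge0; apply: le_trans (sqr_ge0 (a * y - b * x)) _; lra.
Qed.

Lemma normc_le_Re_Im z : normc z <= `|complex.Re z| + `|complex.Im z|.
Proof.
rewrite -(@ler_pXn2r _ 2)// ?nnegrE ?addr_ge0 ?normc_ge0//.
rewrite normc_sqr /cdot sqrrD !real_normK ?num_real// -!expr2.
by rewrite lerD2r lerDl mulrn_wge0// mulr_ge0.
Qed.

Lemma cdot_mulr z q : cdot z (z * q) = normc z ^+ 2 * complex.Re q.
Proof. by rewrite normc_sqr; case: z q => [x y] [a b]; rewrite /cdot /=; ring. Qed.

Lemma normcB z w : normc (z - w) = normc (w - z).
Proof. by rewrite -normcN opprB. Qed.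

Lemma normc_dist z w : normc z - normc w <= normc (z - w).
Proof. by rewrite lerBlDr; rewrite -{1}(subrK w z); exact: le_normcD. Qed.

Lemma normc_real (a : R) : 0 <= a -> normc a%:C = a.
Proof. by move=> a0; rewrite /= expr0n /= addr0 sqrtr_sqr ger0_norm. Qed.

Lemma norm_normc z : `|z| = (normc z)%:C.
Proof. by rewrite normc_def; case: z. Qed.

Lemma continuous_normc (z : R[i]^o) :
  continuous_at z (@normc R : R[i]^o -> R^o).
Proof.
apply/(@cvgrPdist_lt _ R^o _ _ (nbhs_filter (z : R[i]^o))) => e e0.
have eC : 0 < e%:C by rewrite ltcR.
have /= := @nbhsx_ballx _ R[i]^o z _ eC.
apply: (@filterS _ (nbhs (z : R[i]^o))) => w.
rewrite /ball /= norm_normc ltcR; apply: le_lt_trans.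
by rewrite ler_norml normc_dist andbT lerNl opprB normcB normc_dist.
Qed.

(** The modulus attains its minimum on a nonempty [K]; this is the source of uniformity over compact
    sets. For empty [K] the value 2 is arbitrary. *)
Lemma compact_Delta_normc_gt (K : set R[i]) :
  compact (K : set R[i]^o) -> K `<=` Delta R ->
  exists2 r : R, 1 < r & forall z, K z -> r <= normc z.
Proof.
move=> cK KD; have [->|K0] := eqVneq K set0; first by exists 2; rewrite ?ltr1n.
have cn : {within (K : set R[i]^o), continuous (@normc R : R[i]^o -> R^o)}.
  by apply: continuous_subspaceT => z; exact: continuous_normc.
have [|c cKc cmin] := @compact_EVT_min R[i]^o R (@normc R) K _ cK cn.
  exact/set0P.
exists (normc c); first by apply: KD; rewrite inE in cKc.
by move=> z Kz; apply: cmin; rewrite inE.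
Qed.

(** The right-hand side of the equation for [g_t], at position [z] under the drive value [a]. At
    [z = a] it is 0, by the convention on division. *)
Definition loewner_field z (a : R[i]) := z * ((a + z) / (a - z)).

(* [q = (zeta + z) / (zeta - z)] satisfies [zeta (1 - q) = - z (1 + q)], whence
   [`|1 + q| <= `|1 - q|], that is [Re q <= 0]. *)
Lemma loewner_field_inward z (zeta : R[i]) : 1 <= normc z -> normc zeta = 1 ->
  cdot z (loewner_field z zeta) <= 0.
Proof.
move=> z1 zeta1; rewrite /loewner_field cdot_mulr mulr_ge0_le0 ?sqr_ge0//.
have [->|zz] := eqVneq zeta z; first by rewrite subrr invr0 mulr0.
have : (zeta + z) / (zeta - z) * (zeta - z) = zeta + z.
  by rewrite mulfVK// subr_eq0.
move: (_ / _) => q h.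
have qE : zeta * (1 - q) = - z * (1 + q).
  apply/eqP; rewrite -subr_eq0.
  have -> : zeta * (1 - q) - - z * (1 + q) = (zeta + z) - q * (zeta - z).
    by ring.
  by rewrite h subrr.
have /(congr1 (@normc R)) := qE; rewrite !normcM zeta1 mul1r normcN => nq.
have : normc (1 + q) ^+ 2 <= normc (1 - q) ^+ 2.
  rewrite ler_pXn2r ?nnegrE ?normc_ge0//.
  by rewrite nq -[leLHS]mul1r ler_wpM2r ?normc_ge0.
by rewrite !normc_sqr /cdot; case: (q) => x y /=; lra.
Qed.

(** Here [c = (r - 1)^-1] bounds [1 / |z - a|] when [|z| >= r] and [|a| = 1]. The estimate below
    yields the coefficients [1 + 2 c^2] for the position and [2 (1 + c)^2] for the drive; the latter
    dominates both. *)
Definition loewner_lip (r : R) : R := 2 * (1 + (r - 1)^-1) ^+ 2.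

(* Division with remainder: [loewner_field z a = - (z + 2 a + 2 a^2 / (z - a))]. *)
Lemma loewner_field_lip (r : R) z w (a b : R[i]) : 1 < r ->
  r <= normc z -> r <= normc w -> normc a = 1 -> normc b = 1 ->
  normc (loewner_field z a - loewner_field w b) <=
  loewner_lip r * (normc (z - w) + normc (a - b)).
Proof.
move=> r1 rz rw a1 b1.
have c0 : 0 < (r - 1)^-1 by rewrite invr_gt0 subr_gt0.
have away u d : r <= normc u -> normc d = 1 -> u - d != 0 /\
    normc (u - d)^-1 <= (r - 1)^-1.
  move=> ru d1; have rud : r - 1 <= normc (u - d).
    by apply: le_trans (normc_dist u d); rewrite d1 lerB.
  have r10 : 0 < r - 1 by rewrite subr_gt0.
  have ud_gt0 := lt_le_trans r10 rud.
  split; last by rewrite normcV lef_pV2.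
  by apply: contraTneq ud_gt0 => ->; rewrite normc0 ltxx.
have [za0 za] := away _ _ rz a1; have [wb0 wb] := away _ _ rw b1.
set x := (z - a)^-1 in za *; set y := (w - b)^-1 in wb *.
(* The remainders are compared through [a^2 x - b^2 y = (a + b) (a - b) x + b^2 (x - y)] and
   [x - y = ((w - z) + (a - b)) x y]. *)
have -> : loewner_field z a - loewner_field w b =
    - ((z - w) + 2 * (a - b) + 2 * ((a + b) * (a - b) * x) +
       2 * (b * b * ((w - z) + (a - b)) * (x * y))).
  rewrite /loewner_field /x /y -(opprB z) -(opprB w) !invrN; field.
  by apply/andP.
rewrite normcN.
have n2 : normc (2 : R[i]) = 2 by rewrite normcMn normc1.
have x0 := normc_ge0 x; have y0 := normc_ge0 y.
set d := normc (z - w); set e := normc (a - b).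
have d0 : 0 <= d := normc_ge0 _; have e0 : 0 <= e := normc_ge0 _.
have ab2 : normc (a + b) <= 2 by apply: le_trans (le_normcD _ _) _; lra.
have wzab : normc ((w - z) + (a - b)) <= d + e.
  by apply: le_trans (le_normcD _ _) _; rewrite normcB.
set c := (r - 1)^-1 in c0 za wb *.
apply: (@le_trans _ _ (d + 2 * e + 2 * (2 * e * c) + 2 * ((d + e) * (c * c)))).
  apply: le_trans (le_normcD _ _) _; apply: lerD; last first.
    rewrite !normcM n2 b1 !mul1r ler_wpM2l// ler_pM ?mulr_ge0 ?normc_ge0//.
    by rewrite ler_pM.
  apply: le_trans (le_normcD _ _) _; apply: lerD; last first.
    by rewrite !normcM n2 ler_wpM2l// ler_pM ?mulr_ge0 ?normc_ge0// ler_wpM2r.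
  by apply: le_trans (le_normcD _ _) _; rewrite normcM n2.
rewrite /loewner_lip -/c; nra.
Qed.

End ComplexDot.

(** * Complex Lebesgue integrals and almost everywhere inequalities *)

Section ComplexIntegral.
Variable R : realType.
Implicit Types (t a b : R) (v : R -> R[i]) (c : R[i]) (A : set R).

Notation mu := (@lebesgue_measure R).

Lemma ae_mono (P Q : R -> Prop) : (forall x, P x -> Q x) ->
  {ae mu, forall x, P x} -> {ae mu, forall x, Q x}.
Proof.
by move=> PQ; apply: filterS PQ; exact: (ae_filter_ringOfSetsType mu).
Qed.

Lemma ae_mono2 (P P' Q : R -> Prop) : (forall x, P x -> P' x -> Q x) ->
  {ae mu, forall x, P x} -> {ae mu, forall x, P' x} -> {ae mu, forall x, Q x}.
Proof.
by move=> PQ; apply: filterS2 PQ; exact: (ae_filter_ringOfSetsType mu).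
Qed.

(** The difference [f2 - f1] agrees almost everywhere with its absolute value, whose integral is
    nonnegative. *)
Lemma ae_le_Rintegral A (f1 f2 : R -> R) : measurable A ->
  mu.-integrable A (EFin \o f1) -> mu.-integrable A (EFin \o f2) ->
  {ae mu, forall x, A x -> f1 x <= f2 x} ->
  \int[mu]_(x in A) f1 x <= \int[mu]_(x in A) f2 x.
Proof.
move=> mA i1 i2 f12.
have i12 : mu.-integrable A (EFin \o (fun x => f2 x - f1 x)).
  rewrite (_ : _ \o _ = (fun x => (f2 x)%:E - (f1 x)%:E)%E)//.
  exact: integrableB.
rewrite -subr_ge0 -RintegralB//.
suff -> : \int[mu]_(x in A) (f2 x - f1 x) = \int[mu]_(x in A) `|f2 x - f1 x|.
  by apply: Rintegral_ge0.
congr fine; apply: ae_eq_integral => //.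
- exact: measurable_int i12.
- apply/measurable_EFinP; apply: measurableT_comp => //.
  by apply/measurable_EFinP; exact: measurable_int i12.
- apply: ae_mono f12 => x f12 /f12 h.
  by rewrite ger0_norm// subr_ge0.
Qed.

Lemma cintegrableS (A B : set R) v : measurable A -> measurable B ->
  B `<=` A -> cintegrable A v -> cintegrable B v.
Proof.
by move=> mA mB BA [iR iI]; split; [exact: integrableS iR|exact: integrableS iI].
Qed.

Lemma cintegrable_cdot A v c : measurable A -> cintegrable A v ->
  mu.-integrable A (EFin \o (fun s => cdot c (v s))).
Proof.
move=> mA [iR iI].
rewrite (_ : _ \o _ = ((fun s => (complex.Re c)%:E * (complex.Re (v s))%:E) \+
   (fun s => (complex.Im c)%:E * (complex.Im (v s))%:E))%E)//.
by apply: integrableD => //; exact: integrableZl.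
Qed.

Lemma cdot_cintegral A v c : measurable A -> cintegrable A v ->
  cdot c (cintegral A v) = \int[mu]_(s in A) cdot c (v s).
Proof.
move=> mA [iR iI]; rewrite {1}/cdot /cintegral /=.
rewrite -!RintegralZl// -RintegralD//.
- exact: (@integrableZl _ _ _ mu A mA _ (fun s => (_ (v s))%:E)).
- exact: (@integrableZl _ _ _ mu A mA _ (fun s => (_ (v s))%:E)).
Qed.

Lemma cintegrableB A v w : measurable A -> cintegrable A v ->
  cintegrable A w -> cintegrable A (fun s => v s - w s).
Proof.
move=> mA [vR vI] [wR wI]; split.
- rewrite (_ : (fun _ => _) =
    (fun s => (complex.Re (v s))%:E - (complex.Re (w s))%:E)%E).
    exact: integrableB.
  by apply/funext => s; case: (v s) (w s) => [? ?] [? ?].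
- rewrite (_ : (fun _ => _) =
    (fun s => (complex.Im (v s))%:E - (complex.Im (w s))%:E)%E).
    exact: integrableB.
  by apply/funext => s; case: (v s) (w s) => [? ?] [? ?].
Qed.

Lemma cintegralB A v w : measurable A -> cintegrable A v ->
  cintegrable A w ->
  cintegral A (fun s => v s - w s) = cintegral A v - cintegral A w.
Proof.
move=> mA [vR vI] [wR wI]; rewrite /cintegral.
have -> : (fun s => complex.Re (v s - w s)) =
    (fun s => complex.Re (v s) - complex.Re (w s)).
  by apply/funext => s; case: (v s) (w s) => [? ?] [? ?].
have -> : (fun s => complex.Im (v s - w s)) =
    (fun s => complex.Im (v s) - complex.Im (w s)).
  by apply/funext => s; case: (v s) (w s) => [? ?] [? ?].
by rewrite !RintegralB.
Qed.

(* Testing against the direction of the integral itself reduces the triangle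
   inequality to a scalar one. *)
Lemma normc_cintegral_le A v (h : R -> R) : measurable A -> cintegrable A v ->
  mu.-integrable A (EFin \o h) ->
  {ae mu, forall s, A s -> normc (v s) <= h s} ->
  normc (cintegral A v) <= \int[mu]_(s in A) h s.
Proof.
move=> mA iv ih vh; set I := cintegral A v.
(* A zero integral gives no direction to test against; the claim is then that [h], nonnegative
   almost everywhere, has nonnegative integral. *)
have [I0|I0] := eqVneq (normc I) 0.
  have := @ae_le_Rintegral A (cst 0) h mA _ ih.
  rewrite Rintegral_cst// mul0r I0; apply; first exact: integrable0.
  by apply: ae_mono vh => s vh /vh; apply: le_trans; exact: normc_ge0.
have I1 : 0 < normc I by rewrite lt_def I0 normc_ge0.
have ihI : mu.-integrable A (EFin \o (fun s => normc I * h s)).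
  exact: (@integrableZl _ _ _ mu A mA _ (EFin \o h)).
have := @ae_le_Rintegral A _ _ mA (cintegrable_cdot I _ iv) ihI.
rewrite -cdot_cintegral// RintegralZl// -/I -normc_sqr expr2 ler_pM2l//.
apply=> //; apply: ae_mono vh => s vh /vh h0.
by apply: le_trans (cdot_le_normc _ _) _; rewrite ler_wpM2l// normc_ge0.
Qed.

Lemma cintegral_itvB v t a b : 0 <= a -> a <= b -> b <= t ->
  cintegrable `[0, t] v ->
  cintegral `[0, b] v - cintegral `[0, a] v = cintegral `]a, b] v.
Proof.
move=> a0 ab bt [iR iI].
have s0b : `[0, b] `<=` `[0, t].
  by apply: subset_itvl; rewrite bnd_simp.
have [jR jI] : cintegrable `[0, b] v by apply: cintegrableS s0b _.
have eR := @Rintegral_itvB R (fun s => complex.Re (v s)) (BLeft 0) (BRight b) a jR.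
have eI := @Rintegral_itvB R (fun s => complex.Im (v s)) (BLeft 0) (BRight b) a jI.
by rewrite !bnd_simp in eR eI; rewrite /cintegral -eR// -eI.
Qed.

End ComplexIntegral.

(** * Differentiation, integration and iteration in one real variable *)

Section RealVariable.
Variable R : realType.

Notation mu := (@lebesgue_measure R).

(** By Lebesgue differentiation the indefinite integral of [u] has derivative [u] almost everywhere,
    and near each interior point [p] differs from it by a constant. *)
Lemma ae_eq_derive_integral (t : R) (p u d : R -> R) :
  mu.-integrable `[0, t] (EFin \o u) ->
  (forall s, s \in `[0, t] -> p s = p 0 + \int[mu]_(r in `[0, s]) u r) ->
  {ae mu, forall s, s \in `]0, t[ -> is_derive s (1 : R) p (d s) -> u s = d s}.
Proof.
(* Extended by zero, the integrand is integrable on every [[0, y]], also beyond [t], as [FTC1]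
   asks. *)
move=> iu pE; set w := u \_ `[0, t]%classic.
have iw : mu.-integrable setT (EFin \o w).
  by rewrite -restrict_EFin; apply/(integrable_mkcond _ _).1.
have /(@FTC1 R w (BLeft 0)) : forall y, mu.-integrable `[0, y] (EFin \o w).
  by move=> y; apply: integrableS iw.
move=> /(_ (integrable_locally (measurable_itv _) iu)) /=.
apply: ae_mono => s /= h st pd.
have /andP[s0 st1] : 0 < s < t by rewrite in_itv in st.
have [dW W'] := h s0; rewrite derive1E in W'.
have us : w s = u s by rewrite /w patchE mem_set//= in_itv /= !ltW.
rewrite -us -W' -[RHS](@derive_val _ _ _ _ _ _ _ pd).
rewrite (_ : 'D_1 p s = 'D_1 (cst (p 0) + (fun y => \int[mu]_(r in `[0, y]) w r)) s).
  by rewrite deriveD ?derive_cst ?add0r//; exact: derivable_cst.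
apply: near_eq_derive; near=> y.
have : y \in `]0, t[ by near: y; exact: near_in_itvoo.
rewrite in_itv /= => /andP[y0 yt].
rewrite pE ?in_itv /= ?ltW//; congr (_ + _); apply: eq_Rintegral => r.
rewrite inE /= in_itv /= => /andP[r0 ry].
by rewrite /w patchE mem_set//= in_itv /= r0 (le_trans ry (ltW yt)).
Unshelve. all: by end_near. Qed.

(** Over [n] equal pieces of [[s, t]] the increments add up to at most [C (t - s)^2 / n], which
    tends to 0. *)
Lemma quadratic_increment_noninc (t C : R) (p : R -> R) :
  (forall a b, 0 <= a -> a <= b -> b <= t -> p b - p a <= C * (b - a) ^+ 2) ->
  forall s, 0 <= s -> s <= t -> p t <= p s.
Proof.
move=> pC s s0 st; rewrite -subr_le0; apply/ler_addgt0Pl => e e0.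
rewrite addr0; set K := C * (t - s) ^+ 2.
have step n : 0 < n%:R :> R -> p t - p s <= K / n%:R.
  move=> n0; set h := (t - s) / n%:R.
  have h0 : 0 <= h by rewrite divr_ge0 ?subr_ge0// ltW.
  have hn : h * n%:R = t - s by rewrite /h divfK ?gt_eqF.
  have ind k : (k <= n)%N -> p (s + h * k%:R) - p s <= C * h ^+ 2 * k%:R.
    elim: k => [|k IH] kn; first by rewrite !mulr0 addr0 subrr.
    have kT : s + h * k.+1%:R <= t.
      by rewrite -lerBrDl -hn ler_wpM2l// ler_nat.
    have := pC (s + h * k%:R) (s + h * k.+1%:R).
    have shk : s + h * k%:R <= s + h * k.+1%:R by rewrite lerD2l ler_wpM2l// ler_nat.
    have hk0 : 0 <= s + h * k%:R by rewrite addr_ge0// mulr_ge0.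
    move=> /(_ hk0 shk kT); have := IH (ltnW kn); rewrite -natr1; lra.
  have tE : s + (t - s) = t by rewrite addrC subrK.
  have := ind n (leqnn _); rewrite hn tE => /le_trans; apply.
  by rewrite /h /K le_eqVlt; apply/orP; left; apply/eqP; field; rewrite gt_eqF.
(* The Archimedean choice of [n] asks for [K / e >= 0]; when [K <= 0] a single piece suffices. The
   successor below keeps [n] positive. *)
have [K0|K0] := leP K 0.
  apply: le_trans (step 1%N ltr01) _; rewrite divr1; apply: le_trans K0 _.
  exact: ltW.
have n0 : 0 < (Num.bound (K / e)).+1%:R :> R by rewrite ltr0n.
apply: le_trans (step _ n0) _; rewrite ler_pdivrMr// mulrC -ler_pdivrMr//.
apply: ltW; apply: lt_trans (archi_boundP _) _; first by rewrite divr_ge0// ltW.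
by rewrite ltr_nat.
Qed.

(** The gain is the factor [l^-1]: for [l] twice a Lipschitz constant, integrating against this
    weight contracts by 1/2. A primitive is [- l^-1] times the weight. *)
Lemma integral_expR_decay (l T s : R) : 0 < l -> s <= T ->
  mu.-integrable `]s, T] (EFin \o (fun r => expR (l * (T - r)))) /\
  \int[mu]_(r in `]s, T]) expR (l * (T - r)) = l^-1 * (expR (l * (T - s)) - 1).
Proof.
move=> l0; set E := fun r => expR (l * (T - r)).
have dE x : is_derive x (1 : R) E (- l * E x).
  rewrite /E; apply: is_derive_eq; rewrite ?derive_val /=.
  by rewrite /GRing.scale /= ; ring.
have cE : continuous E.
  by move=> x; apply/differentiable_continuous/derivable1_diffP; case: (dE x).
have iE : mu.-integrable `[s, T] (EFin \o E).
  apply: continuous_compact_integrable; first exact: segment_compact.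
  exact: continuous_subspaceT.
have iE' : mu.-integrable `]s, T] (EFin \o E).
  by apply: integrableS iE => //; apply: subset_itvr; rewrite bnd_simp.
rewrite le_eqVlt => /predU1P[sT|sT]; split=> //.
  by rewrite sT subrr mulr0 expR0 subrr mulr0 set_itvoc0 Rintegral_set0.
rewrite Rintegral_itv_obnd_cbnd// /Rintegral.
rewrite (@continuous_FTC2 _ E (fun r => - l^-1 * E r) s T)//=.
- by rewrite /E subrr mulr0 expR0; ring.
- exact: continuous_subspaceT.
- have cF : continuous (fun r => - l^-1 * E r).
    move=> x; apply: (@continuousM _ _ (fun=> - l^-1) E x); last exact: cE.
    exact: cst_continuous.
  split=> [x _||].
  + by apply: derivableM; [exact: derivable_cst|case: (dE x)].
  + by apply: cvg_at_right_filter; exact: cF.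
  + by apply: cvg_at_left_filter; exact: cF.
- move=> x _; rewrite derive1E.
  have -> : (fun r => - l^-1 * E r) = - l^-1 \*: E by [].
  rewrite deriveZ; last by case: (dE x).
  by rewrite derive_val /GRing.scale /= mulrA mulrNN mulVf ?mul1r// gt_eqF.
Qed.

(* Iterating the hypothesis from any a priori bound [B] halves the excess over
   the fixed point [2 a] of [m |-> a + m / 2]. *)
Lemma halving_bound (P : R -> Prop) (a B : R) :
  (forall m, 0 <= m -> P m -> P (a + m / 2)) -> 0 <= a -> 0 <= B -> P B ->
  forall e, 0 < e -> exists2 m, m <= 2 * a + e & P m.
Proof.
move=> step a0 B0 PB e e0.
have it n : exists m, [/\ 0 <= m, m <= 2 * a + B / 2 ^+ n & P m].
  elim: n => [|n [m [m0 mle Pm]]].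
    by exists B; split => //; rewrite expr0 divr1 lerDr mulr_ge0.
  exists (a + m / 2); split; last exact: step.
    by rewrite addr_ge0 ?divr_ge0.
  by rewrite exprSr invfM mulrA; lra.
(* Since [n < 2 ^ n], this choice makes [B / 2 ^ n <= e]. *)
pose n := Num.bound (B / e).
have [m [_ mle Pm]] := it n; exists m => //; apply: le_trans mle _.
rewrite lerD2l ler_pdivrMr ?exprn_gt0// mulrC -ler_pdivrMr//.
apply: ltW; apply: lt_le_trans (archi_boundP _) _; first by rewrite divr_ge0// ltW.
by rewrite -natrX ler_nat ltnW// ltn_expl.
Qed.

End RealVariable.

(** * Orbits of the Loewner equation: integral form, bounds, monotone modulus *)

Section Orbits.
Variable R : realType.
Implicit Types (phi g : R -> R[i]) (w : R[i]) (s t T : R).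

Notation mu := (@lebesgue_measure R).

Lemma loewner_orbit_gap phi w t g : loewner_orbit phi w t g ->
  exists2 m, 0 < m &
    forall s, s \in `[0, t] -> m <= normc (g s - phi s).
Proof.
move=> [_ _ _ m0]; exists (inf [set normc (g s - phi s) | s in `[0, t]]) => //.
move=> s st; apply: ge_inf; last by exists s.
by exists 0 => _ [r _ <-]; exact: normc_ge0.
Qed.

Lemma loewner_orbit_sub phi w s t g : 0 <= s -> s <= t ->
  loewner_orbit phi w t g -> loewner_orbit phi w s g.
Proof.
move=> s0 st orb; have [m m0 gap] := loewner_orbit_gap orb.
have sub r : r \in `[0, s] -> r \in `[0, t].
  by rewrite !in_itv /= => /andP[-> rs]; exact: le_trans st.
case: orb => [g0 [v iv gE] dg _]; split => //.
- exists v; first by apply: cintegrableS iv => // r; exact: sub.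
  by move=> r /sub; exact: gE.
- apply: ae_mono dg => r h; rewrite in_itv /= => /andP[r0 rs]; apply: h.
  by rewrite in_itv /= r0 (lt_le_trans rs st).
(* Nonemptiness matters, the infimum of the empty set being 0 by default; time 0 supplies a
   point. *)
- apply: (lt_le_trans m0); apply: lb_le_inf.
    by exists (normc (g 0 - phi 0)); exists 0 => //=; rewrite in_itv /= lexx s0.
  by move=> _ [r /sub rt <-]; exact: gap.
Qed.

(** Absolute continuity provides some integrand [v]; differentiating real and imaginary parts
    identifies it almost everywhere with the field. Later estimates integrate [v], whose
    integrability comes with the orbit. *)
Lemma loewner_orbit_integral phi w t g : loewner_orbit phi w t g ->
  exists v, [/\ cintegrable `[0, t] v,
    forall s, s \in `[0, t] -> g s = g 0 + cintegral `[0, s] v,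
    forall a b, 0 <= a -> a <= b -> b <= t -> g b - g a = cintegral `]a, b] v &
    {ae mu, forall s, s \in `]0, t] -> v s = loewner_field (g s) (phi s)}].
Proof.
move=> [_ [v iv gE] dg _]; exists v; split=> // [a b a0 ab bt|].
  have at0 : a \in `[0, t] by rewrite in_itv /= a0 (le_trans ab bt).
  have bt0 : b \in `[0, t] by rewrite in_itv /= bt (le_trans a0 ab).
  rewrite -(cintegral_itvB a0 ab bt iv) (gE _ bt0) (gE _ at0).
  by rewrite opprD addrACA subrr add0r.
(* The equation is given on the open interval; discarding the null set [{t}] reaches the half-open
   one. *)
have neq : {ae mu, forall s, s != t}.
  exists [set t]; split; [exact: measurable_set1|exact: lebesgue_measure_set1|].
  by move=> s /= /negP; rewrite negbK => /eqP.
have ReD (x y : R[i]) : complex.Re (x + y) = complex.Re x + complex.Re y.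
  by case: x y => [? ?] [? ?].
have ImD (x y : R[i]) : complex.Im (x + y) = complex.Im x + complex.Im y.
  by case: x y => [? ?] [? ?].
have iRe := @ae_eq_derive_integral R t (fun s => complex.Re (g s)) _
  (fun s => complex.Re (loewner_field (g s) (phi s))) iv.1.
have iIm := @ae_eq_derive_integral R t (fun s => complex.Im (g s)) _
  (fun s => complex.Im (loewner_field (g s) (phi s))) iv.2.
have {}iRe := iRe (fun s st => etrans (congr1 _ (gE s st)) (ReD _ _)).
have {}iIm := iIm (fun s st => etrans (congr1 _ (gE s st)) (ImD _ _)).
have iReIm := ae_mono2 (fun s a b => conj a b) iRe iIm.
have := ae_mono2 (fun s a b => conj a b) dg iReIm.
apply: ae_mono2 neq => s st [ds [eR eI]]; rewrite in_itv /= => /andP[s0 sle].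
have st' : s \in `]0, t[ by rewrite in_itv /= s0 lt_neqAle st.
have [dR dI] := ds st'.
by apply/eqP; rewrite eq_complex eR// eI// !eqxx.
Qed.

(** A crude bound, [|g 0|] plus the integral of [|Re v| + |Im v|]. It serves to bound the speed of
    an orbit and to start the Gronwall iteration. *)
Lemma loewner_orbit_bounded phi w t g : loewner_orbit phi w t g ->
  exists2 B, 0 <= B & forall s, s \in `[0, t] -> normc (g s) <= B.
Proof.
move=> /loewner_orbit_integral[v [iv gE _ _]].
pose h s := `|complex.Re (v s)| + `|complex.Im (v s)|.
have ih : mu.-integrable `[0, t] (EFin \o h).
  rewrite (_ : EFin \o h = (EFin \o (fun s => `|complex.Re (v s)|)%R) \+
    (EFin \o (fun s => `|complex.Im (v s)|)%R))%E//.
  by case: iv => /integrable_norm iR /integrable_norm iI; exact: integrableD.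
have h0 s : 0 <= h s by rewrite addr_ge0.
exists (normc (g 0) + \int[mu]_(s in `[0, t]) h s).
  by rewrite addr_ge0 ?normc_ge0// Rintegral_ge0.
move=> s st; have /andP[s0 st'] : 0 <= s <= t by rewrite in_itv in st.
rewrite (gE s st); apply: le_trans (le_normcD _ _) _; rewrite lerD2l.
have s0t : `[0, s] `<=` `[0, t] by apply: subset_itvl; rewrite bnd_simp.
have ihs : mu.-integrable `[0, s] (EFin \o h) by apply: integrableS ih.
apply: (@le_trans _ _ (\int[mu]_(r in `[0, s]) h r)).
  apply: normc_cintegral_le => //; first exact: cintegrableS iv.
  by apply: aeW => r _; exact: normc_le_Re_Im.
rewrite -subr_ge0.
have := @Rintegral_itvB R h (BLeft 0) (BRight t) s ih; rewrite !bnd_simp => ->//.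
by apply: Rintegral_ge0.
Qed.

Lemma normc_loewner_field_le (z a : R[i]) (B m : R) :
  0 < m -> m <= normc (z - a) -> normc a = 1 -> normc z <= B ->
  normc (loewner_field z a) <= B * ((1 + B) / m).
Proof.
move=> m0 mza a1 zB; rewrite /loewner_field !normcM.
rewrite ler_pM ?mulr_ge0 ?normc_ge0// ler_pM ?normc_ge0//.
  by apply: le_trans (le_normcD _ _) _; rewrite a1 lerD2l.
by rewrite normcV normcB lef_pV2// posrE// (lt_le_trans m0).
Qed.

Lemma Rintegral_cst_itvoc (a b k : R) : a <= b ->
  \int[mu]_(s in `]a, b]) k = k * (b - a).
Proof.
move=> ab; rewrite Rintegral_cst //= lebesgue_measure_itv /= lte_fin.
by move: ab; rewrite le_eqVlt => /predU1P[->|->//]; rewrite ltxx subrr.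
Qed.

(* With velocity bounded by [C], replacing [g r] by [g b] in the integrand of
   [cdot (g b) (g b - g a)] costs at most [C^2 (b - a)^2], which subdivision
   makes negligible. *)
Lemma loewner_orbit_normc_noninc phi w t g :
  (forall s, s \in `[0, t] -> normc (phi s) = 1) ->
  (forall s, s \in `[0, t] -> 1 <= normc (g s)) ->
  loewner_orbit phi w t g ->
  forall s, s \in `[0, t] -> normc (g t) <= normc (g s).
Proof.
move=> phi1 g1 orb s; rewrite in_itv /= => /andP[s0 st].
have [m m0 gap] := loewner_orbit_gap orb.
have [B B0 gB] := loewner_orbit_bounded orb.
have [v [iv _ gD vE]] := loewner_orbit_integral orb.
set C := B * ((1 + B) / m).
have C0 : 0 <= C by rewrite /C mulr_ge0// divr_ge0 ?addr_ge0// ltW.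
have in0t a b r : 0 <= a -> b <= t -> r \in `]a, b] ->
    r \in `[0, t] /\ r \in `]0, t].
  move=> a0 bt; rewrite !in_itv /= => /andP[ar rb].
  by rewrite (le_lt_trans a0 ar) (ltW (le_lt_trans a0 ar)) (le_trans rb bt).
have ivab a b : 0 <= a -> b <= t -> cintegrable `]a, b] v.
  by move=> a0 bt; apply: cintegrableS iv => // r /(in0t _ _ _ a0 bt)[].
have FC r : r \in `[0, t] -> normc (loewner_field (g r) (phi r)) <= C.
  by move=> rt; apply: normc_loewner_field_le => //; auto.
have icst (k a b : R) : mu.-integrable `]a, b] (EFin \o (fun=> k)).
  apply: (@integrableS _ _ _ mu `[a, b]) => //; first exact: subset_itv_oc_cc.
  apply: continuous_compact_integrable; first exact: segment_compact.
  by apply: continuous_subspaceT => x; exact: cst_continuous.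
have gLip a b : 0 <= a -> a <= b -> b <= t -> normc (g b - g a) <= C * (b - a).
  move=> a0 ab bt; rewrite gD// -Rintegral_cst_itvoc//.
  apply: normc_cintegral_le; [by []|exact: ivab|exact: icst|].
  by apply: ae_mono vE => r vr /(in0t _ _ _ a0 bt)[rt rt']; rewrite vr//; exact: FC.
rewrite -(@ler_pXn2r _ 2)// ?nnegrE ?normc_ge0//.
apply: (@quadratic_increment_noninc _ t (2 * C ^+ 2)
  (fun r => normc (g r) ^+ 2)) => //.
move=> a b a0 ab bt.
have -> : normc (g b) ^+ 2 - normc (g a) ^+ 2 =
    2 * cdot (g b) (g b - g a) - cdot (g b - g a) (g b - g a).
  by rewrite !normc_sqr; case: (g a) (g b) => [? ?] [? ?]; rewrite /cdot /=; ring.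
rewrite -[cdot (g b - g a) _]normc_sqr.
suff : cdot (g b) (g b - g a) <= C ^+ 2 * (b - a) ^+ 2.
  by have := sqr_ge0 (normc (g b - g a)); lra.
rewrite [in leLHS]gD// cdot_cintegral//; last exact: ivab.
rewrite [leRHS](_ : _ = C ^+ 2 * (b - a) * (b - a)); last by ring.
rewrite -Rintegral_cst_itvoc//; apply: ae_le_Rintegral => //.
  by apply: cintegrable_cdot => //; exact: ivab.
apply: ae_mono vE => r vr rab; have [rt rt'] := in0t _ _ _ a0 bt rab.
rewrite vr//; move: rab => /=; rewrite in_itv /= => /andP[ar rb].
have r0 : 0 <= r := le_trans a0 (ltW ar).
set F := loewner_field _ _.
have -> : cdot (g b) F = cdot (g r) F + cdot (g b - g r) F.
  by rewrite cdotBl addrC subrK.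
have := loewner_field_inward (g1 _ rt) (phi1 _ rt); rewrite -/F.
suff : cdot (g b - g r) F <= C ^+ 2 * (b - a) by lra.
apply: le_trans (cdot_le_normc _ _) _.
have -> : C ^+ 2 * (b - a) = C * (b - a) * C by ring.
apply: ler_pM; rewrite ?normc_ge0 ?FC//.
by apply: le_trans (gLip _ _ r0 rb bt) _; rewrite ler_wpM2l// lerB// ltW.
Qed.

End Orbits.

(** * Stability of orbits under a change of drive *)

Section Stability.
Variable R : realType.

Notation mu := (@lebesgue_measure R).

(** Points of the unit circle are at most 2 apart, which gives an integrable bound. *)
Lemma integrable_drive_dist (T : R) (phi psi : drive T) :
  mu.-integrable `[0, T] (EFin \o (fun s => normc (phi s - psi s))).
Proof.
apply: (@le_integrable _ _ _ mu _ _ _ (EFin \o (fun=> 2))) => //.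
- apply/measurable_EFinP.
  rewrite (_ : (fun _ => _) = Num.sqrt \o (fun s =>
    (complex.Re (phi s) - complex.Re (psi s)) ^+ 2 +
    (complex.Im (phi s) - complex.Im (psi s)) ^+ 2)); last first.
    by apply/funext => s /=; case: (phi s) (psi s) => [? ?] [? ?].
  apply: measurableT_comp.
    by apply: continuous_measurable_fun; exact: sqrt_continuous.
  apply: measurable_funD; apply: measurable_funX; apply: measurable_funB;
    exact: measurable_drive_Re || exact: measurable_drive_Im.
- move=> s sT; rewrite lee_fin ger0_norm ?normc_ge0// ger0_norm//.
  by apply: le_trans (le_normcD _ _) _; rewrite normcN !drive_circle.
- apply: continuous_compact_integrable; first exact: segment_compact.
  by apply: continuous_subspaceT => x; exact: cst_continuous.
Qed.

(* Gronwall's inequality, run backwards from the common end point at time [T]. *)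
Lemma loewner_orbit_stability (T r : R) (phi psi : drive T) (w1 w2 : R[i])
    (g k : R -> R[i]) : 0 < T -> 1 < r ->
  loewner_orbit phi w1 T g -> loewner_orbit psi w2 T k -> g T = k T ->
  (forall s, s \in `[0, T] -> r <= normc (g s)) ->
  (forall s, s \in `[0, T] -> r <= normc (k s)) ->
  normc (w1 - w2) <=
  2 * loewner_lip r * L1dist phi psi * expR (2 * loewner_lip r * T).
Proof.
move=> T0 r1 og ok gkT rg rk; set M := loewner_lip r; set delta := L1dist phi psi.
have M0 : 0 < M.
  by rewrite /M /loewner_lip mulr_gt0// exprn_gt0// addr_gt0// invr_gt0 subr_gt0.
have delta0 : 0 <= delta by apply: Rintegral_ge0 => s _; exact: normc_ge0.
have [Bg Bg0 gB] := loewner_orbit_bounded og.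
have [Bk Bk0 kB] := loewner_orbit_bounded ok.
have [v [iv _ gD vE]] := loewner_orbit_integral og.
have [u [iu _ kD uE]] := loewner_orbit_integral ok.
(* The weight of a supremum norm; its rate, twice the Lipschitz constant [M], makes the integral
   operator halve a bound. *)
pose E s := expR (2 * M * (T - s)).
have E1 s : s <= T -> 1 <= E s.
  by move=> sT; rewrite -expR0 ler_expR mulr_ge0 ?subr_ge0// mulr_ge0// ltW.
pose P m := forall s, s \in `[0, T] -> normc (g s - k s) <= m * E s.
have PB : P (Bg + Bk).
  move=> s sT; apply: le_trans (le_normcD _ _) _; rewrite normcN.
  apply: (le_trans (lerD (gB _ sT) (kB _ sT))).
  by rewrite ler_peMr ?addr_ge0// E1//; move: sT; rewrite in_itv => /andP[].
have stepP m : 0 <= m -> P m -> P (M * delta + m / 2).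
  move=> m0 Pm s sT; have /andP[s0 sT'] : 0 <= s <= T by rewrite in_itv in sT.
  have sub : `]s, T] `<=` `[0, T].
    move=> x; rewrite /= !in_itv /= => /andP[sx ->].
    by rewrite (le_trans s0 (ltW sx)).
  have ivs : cintegrable `]s, T] v by apply: cintegrableS iv.
  have ius : cintegrable `]s, T] u by apply: cintegrableS iu.
  (* The end points at time [T] agree, so the gap at time [s] is the accumulated difference of
     velocities. *)
  have gkE : k s - g s = cintegral `]s, T] (fun x => v x - u x).
    rewrite cintegralB// -gD// -kD// gkT.
    by rewrite opprD addrACA subrr add0r opprK addrC.
  have [iE EE] := @integral_expR_decay R (2 * M) T s (mulr_gt0 (ltr0Sn R 1) M0) sT'.
  have iN : mu.-integrable `]s, T] (EFin \o (fun x => normc (phi x - psi x))).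
    by apply: integrableS (integrable_drive_dist phi psi).
  have iME : mu.-integrable `]s, T] (EFin \o (fun x => M * m * E x)).
    exact: (@integrableZl _ _ _ mu `]s, T] _ _ (EFin \o E)).
  have iMN : mu.-integrable `]s, T]
      (EFin \o (fun x => M * normc (phi x - psi x))).
    exact: (@integrableZl _ _ _ mu `]s, T] _ _
      (EFin \o (fun x => normc (phi x - psi x)))).
  rewrite normcB gkE.
  apply: (@le_trans _ _ (\int[mu]_(x in `]s, T])
      (M * m * E x + M * normc (phi x - psi x)))).
    apply: normc_cintegral_le => //; first exact: cintegrableB.
      rewrite (_ : _ \o _ = ((EFin \o (fun x => M * m * E x)%R) \+
        (EFin \o (fun x => M * normc (phi x - psi x))%R))%E)//.
      exact: integrableD.
    apply: ae_mono2 vE uE => x vx ux xs.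
    have xT := sub _ xs.
    have xT' : x \in `]0, T].
      move: xs; rewrite /= !in_itv /= => /andP[sx ->].
      by rewrite (le_lt_trans s0 sx).
    rewrite vx// ux//.
    have phi1 := drive_circle phi xT; have psi1 := drive_circle psi xT.
    apply: le_trans (loewner_field_lip r1 (rg _ xT) (rk _ xT) phi1 psi1) _.
    rewrite -/M mulrDr lerD2r -mulrA ler_wpM2l// ?(ltW M0)//.
    exact: Pm.
  rewrite RintegralD// !RintegralZl// EE -/(E s).
  have Nd : \int[mu]_(x in `]s, T]) normc (phi x - psi x) <= delta.
    have := @Rintegral_itvB R _ (BLeft 0) (BRight T) s
      (integrable_drive_dist phi psi).
    rewrite !bnd_simp => <-//; rewrite lerBlDr lerDl.
    by apply: Rintegral_ge0 => x _; exact: normc_ge0.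
  have -> : M * m * ((2 * M)^-1 * (E s - 1)) = m / 2 * (E s - 1).
    by field; rewrite gt_eqF.
  have Md : M * (\int[mu]_(x in `]s, T]) normc (phi x - psi x)) <= M * delta.
    by rewrite ler_wpM2l// ltW.
  have Mdelta0 : 0 <= M * delta by rewrite mulr_ge0// ltW.
  (* [1 <= E s] turns [M * delta] into [M * delta * E s], and the leftover [- m / 2] is dropped. *)
  have := ler_wpM2l Mdelta0 (E1 _ sT'); lra.
have E00 : 0 < E 0 by exact: expR_gt0.
have -> : expR (2 * M * T) = E 0 by rewrite /E subr0.
have [g0 _ _ _] := og; have [k0 _ _ _] := ok.
(* The iteration reaches [2 * (M * delta)] only up to an arbitrary [e > 0]; its bound is read off at
   time 0, where the orbits are at [w1] and [w2]. *)
rewrite -ler_pdivrMr//; apply/ler_addgt0Pr => e e0.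
have Md0 : 0 <= M * delta by rewrite mulr_ge0// ltW.
have [m mle Pm] := halving_bound stepP Md0 (addr_ge0 Bg0 Bk0) PB e0.
rewrite mulrA in mle; apply: le_trans mle.
by rewrite ler_pdivrMr// -g0 -k0; apply: Pm; rewrite in_itv /= lexx ltW.
Qed.

(** The forward clause of the solution, applied to the orbit cut at each intermediate time, keeps it
    in [Delta]; the modulus is then nonincreasing and ends at [|z|]. *)
Lemma loewner_solution_orbit (T : R) (phi : drive T) f z : 0 < T ->
  loewner_solution T phi f -> Delta R z ->
  exists g, [/\ loewner_orbit phi (f T z) T g, g T = z &
    forall s, s \in `[0, T] -> normc z <= normc (g s)].
Proof.
move=> T0 [_ _ back forw] zD.
have TT : T \in `[0, T] by rewrite in_itv /= lexx ltW.
have [wD [g og gT]] := back _ _ TT zD.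
exists g; split=> // s sT; rewrite -gT.
apply: (loewner_orbit_normc_noninc _ _ og) sT; first exact: drive_circle.
move=> x xT; have /andP[x0 xT'] : 0 <= x <= T by rewrite in_itv in xT.
have [gD _] := forw _ _ _ xT wD (loewner_orbit_sub x0 xT' og).
exact: ltW.
Qed.

End Stability.

Unset Implicit Arguments.

Theorem proposition3p1 (R : realType) (T : R) (hT : 0 < T)
    (L : drive T -> Sigma' R) (hL : loewner_mapping L) :
  loewner_continuous L.
Proof.
move=> phi K cK KD e e0.
have [r r1 rK] := compact_Delta_normc_gt cK KD.
(* The factor of [L1dist phi psi] in the stability bound; depending only on [T] and [r], it lets
   [e / C] serve for all of [K]. *)
set C := 2 * loewner_lip r * expR (2 * loewner_lip r * T).
have lip0 : 0 < loewner_lip r.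
  by rewrite /loewner_lip mulr_gt0// exprn_gt0// addr_gt0// invr_gt0 subr_gt0.
have C0 : 0 < C by rewrite mulr_gt0 ?expR_gt0// mulr_gt0.
exists (e / C); first by rewrite divr_gt0.
move=> psi dist z Kz; have zD := KD _ Kz.
have [f1 sol1 ->//] := hL phi; have [f2 sol2 ->//] := hL psi.
have [g [og gT gz]] := loewner_solution_orbit hT sol1 zD.
have [k [ok kT kz]] := loewner_solution_orbit hT sol2 zD.
have rz := rK _ Kz.
have := loewner_orbit_stability hT r1 og ok (etrans gT (esym kT))
  (fun s sT => le_trans rz (gz s sT)) (fun s sT => le_trans rz (kz s sT)).
move=> stab; rewrite -mulrBr normcM normc_real ?expR_ge0//.
(* The normalizing factor does not increase distances, so the bound on [f_T] passes to [L]. *)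
have expT : expR (- T) <= 1 by rewrite -expR0 ler_expR oppr_le0 ltW.
apply: le_lt_trans (_ : normc (f1 T z - f2 T z) < e).
  by rewrite ler_piMl// normc_ge0.
apply: le_lt_trans stab _.
by rewrite mulrAC -/C mulrC -ltr_pdivlMr.
Qed.
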